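(* For all positive integers $n$ and $k$ with $n \geq k$, $SP(n,k) \geq k \cdot SP(n-k,k)$.
   Context: A $k$-partition of a finite set $X$ is a collection of exactly $k$ pairwise disjoint non-empty subsets of $X$ (called classes) whose union is $X$. A Sperner $k$-partition system on $X$ is a set $\mathcal{P}$ of $k$-partitions of $X$ such that for any two distinct partitions $P, Q \in \mathcal{P}$, no class of $P$ is a subset of (in particular, equal to) a class of $Q$. $SP(n,k)$ denotes the maximum number of partitions in a Sperner $k$-partition system on a set of $n$ elements (so $SP(n,k)=0$ if $n<k$, since then there are no $k$-partitions). *)

(* Defs.v *)
From mathcomp Require Import all_boot.

Set Implicit Arguments.
Unset Strict Implicit.
Unset Printing Implicit Defensive.

(* MathComp's [partition] already requires set0 \notin P, so classes are
   non-empty. *)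
Definition kpartition (T : finType) (k : nat) (P : {set {set T}}) : bool :=
  partition P [set: T] && (#|P| == k).

Definition sperner_system (T : finType) (k : nat)
    (S : {set {set {set T}}}) : bool :=
  [forall P in S, kpartition k P] &&
  [forall P in S, forall Q in S, (P != Q) ==>
     [forall A in P, forall B in Q, ~~ (A \subset B)]].

(* The maximum is over a non-empty family, since set0 is always a system. *)
Definition SP (n k : nat) : nat :=
  \max_(S : {set {set {set 'I_n}}} | sperner_system k S) #|S|.

(* Main.v *)
Require Import Defs.
From mathcomp Require Import all_boot.
From mathcomp Require Import ssralg zmodp.

Set Implicit Arguments.
Unset Strict Implicit.
Unset Printing Implicit Defensive.

(** Put [m = n - k].  Start from a largest Sperner [k]-partition system [S] on
    [m] points and adjoin [k] new points, indexed by the cyclic group of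
    order [k].  Number the classes of each [P] in [S] by that group as well, and
    for each shift [s] send the new point number [i + s] into the class number
    [i].  Every [P] thus yields [k] partitions of the [m + k] points into [k]
    classes, each class containing exactly one new point.

    Suppose that a class obtained from [(P, s)] lies inside one obtained from
    [(Q, t)].  Erasing the new points leaves an inclusion between a class of [P]
    and a class of [Q], so [P = Q] because [S] is Sperner.  The two old classes
    are then comparable members of a single partition, hence equal, and they
    received the same new point, so [s = t].  This one fact
    ([shifted_class_inj]) shows both that the [k * #|S|] new partitions are
    distinct and that they form a Sperner system. *)

(** * Adjoining one new point to each class *)

Section AdjoinPoints.

Variables m k : nat.
Implicit Types (A B : {set 'I_m}) (P : {set {set 'I_m}}).

Definition extend_class A (c : 'I_k) : {set 'I_(m + k)} :=
  [set lshift k x | x in A] :|: [set rshift m c].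

Definition extend_partition (c : {set 'I_m} -> 'I_k) P :=
  [set extend_class A (c A) | A in P].

Lemma mem_extend_lshift A c x : (lshift k x \in extend_class A c) = (x \in A).
Proof.
by rewrite !inE eq_lrshift orbF mem_imset //; apply: lshift_inj.
Qed.

Lemma mem_extend_rshift A c d : (rshift m d \in extend_class A c) = (d == c).
Proof.
rewrite !inE (inj_eq (@rshift_inj _ _)).
suff /negbTE-> : rshift m d \notin [set lshift k x | x in A] by [].
by apply/imsetP => -[x _ /eqP]; rewrite eq_rlshift.
Qed.

(** Erasing the new points is a restriction to the old ones, and preserves
    inclusions; each extended class has a single new point, so inclusion forces
    these to agree. *)
Lemma extend_class_subset A B c d :
  (extend_class A c \subset extend_class B d) = (A \subset B) && (c == d).
Proof.
apply/subsetP/andP => [sAB | [/subsetP sAB /eqP<-] z].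
  split; last by rewrite -(mem_extend_rshift B) sAB // mem_extend_rshift.
  apply/subsetP => x xA.
  by rewrite -(mem_extend_lshift B d) sAB // mem_extend_lshift.
case: (split_ordP z) => y ->; rewrite ?mem_extend_rshift //.
by rewrite !mem_extend_lshift; apply: sAB.
Qed.

Lemma extend_class_disjoint A B c d :
  [disjoint A & B] -> c != d -> [disjoint extend_class A c & extend_class B d].
Proof.
move=> dAB ncd; rewrite disjoint_subset; apply/subsetP => z.
rewrite [z \in [predC _]]inE /=; case: (split_ordP z) => y ->.
  by rewrite !mem_extend_lshift => yA; rewrite (disjointFr dAB yA).
by rewrite !mem_extend_rshift => /eqP->.
Qed.

(** An injective labelling of the [k] classes uses every label, by counting;
    this is why the extended classes also cover all the new points. *)
Lemma extend_partition_kpartition (c : {set 'I_m} -> 'I_k) P :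
  kpartition k P -> {in P &, injective c} -> kpartition k (extend_partition c P).
Proof.
move=> /andP[/and3P[/eqP covP trivP P0] /eqP cardP] c_inj.
have c_onto d : exists2 A, A \in P & d = c A.
  apply/imsetP; suff -> : c @: P = setT by [].
  by apply/eqP; rewrite eqEcard subsetT cardsT card_ord card_in_imset ?cardP /=.
apply/andP; split; last first.
  rewrite card_in_imset ?cardP // => A B AP BP eqAB; apply: c_inj => //.
  have := subxx (extend_class A (c A)).
  by rewrite {2}eqAB extend_class_subset => /andP[_ /eqP].
apply/and3P; split.
- rewrite eqEsubset subsetT; apply/subsetP => z _; apply/bigcupP.
  case: (split_ordP z) => y ->.
    have /bigcupP[A AP yA] : y \in cover P by rewrite covP inE.
    by exists (extend_class A (c A)); [exact: imset_f | rewrite mem_extend_lshift].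
  have [A AP ->] := c_onto y.
  by exists (extend_class A (c A)); [exact: imset_f | rewrite mem_extend_rshift].
- apply/trivIsetP => _ _ /imsetP[A AP ->] /imsetP[B BP ->] neqAB.
  have nAB : A != B by apply: contraNneq neqAB => ->.
  apply: extend_class_disjoint; first by move/trivIsetP: trivP; apply.
  by apply: contra_neq nAB; apply: c_inj.
- apply/imsetP => -[A _ eq0]; have := mem_extend_rshift A (c A) (c A).
  by rewrite -eq0 inE eqxx.
Qed.

End AdjoinPoints.

(** * Cyclic shifts *)

Section CyclicShifts.

Variables m k : nat.
Implicit Types (A B : {set 'I_m}) (P Q : {set {set 'I_m}}) (s t : 'I_k.+1).

(** The numbering is by [k.+1] because only then do the ordinals carry the
    cyclic addition used for the shift. *)
Definition shifted_label P s A : 'I_k.+1 := (inZp (index A (enum P)) + s)%R.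

Definition shifted_partition P s := extend_partition (shifted_label P s) P.

(** A partition into [k.+1] classes has all its positions below [k.+1], so
    reduction modulo [k.+1] identifies no two of them. *)
Lemma shifted_label_inj P s :
  #|P| = k.+1 -> {in P &, injective (shifted_label P s)}.
Proof.
move=> cardP A B AP BP /GRing.addIr /(congr1 val) /=.
have lt_index C : C \in P -> index C (enum P) < k.+1.
  by move=> CP; rewrite -cardP cardE index_mem mem_enum.
rewrite !modn_small ?lt_index // => /(congr1 (nth set0 (enum P))).
by rewrite !nth_index ?mem_enum.
Qed.

(** The Sperner property of [S] identifies [P] with [Q]; inside one partition
    comparable classes coincide, and then equal labels force equal shifts, by
    cancellation in the cyclic group. *)
Lemma shifted_class_inj (S : {set {set {set 'I_m}}}) P Q s t A B :
    sperner_system k.+1 S -> P \in S -> Q \in S -> A \in P -> B \in Q ->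
    extend_class A (shifted_label P s A)
      \subset extend_class B (shifted_label Q t B) ->
  (P, s) = (Q, t).
Proof.
move=> /andP[/forall_inP kparS /forall_inP spernerS] PS QS AP BQ.
rewrite extend_class_subset => /andP[sAB /eqP eq_label].
have eqPQ : P = Q.
  apply/eqP; apply: contraLR sAB => neqPQ.
  have /forall_inP/(_ Q QS)/implyP/(_ neqPQ) := spernerS P PS.
  by move/forall_inP/(_ A AP)/forall_inP; apply.
rewrite -{Q QS}eqPQ in BQ eq_label *.
have /andP[/and3P[_ /trivIsetP trivP P0] _] := kparS P PS.
have eqAB : A = B.
  (* Otherwise A is disjoint from B and included in it, hence empty. *)
  apply/eqP; apply: contraNT P0 => /(trivP A B AP BQ).
  by rewrite -setI_eq0 (setIidPl sAB) => /eqP <-.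
by move: eq_label; rewrite -eqAB => /GRing.addrI ->.
Qed.

(** By [shifted_class_inj], an inclusion between classes reveals the pair
    [(P, s)] behind them.  Since partitions into a positive number of classes
    have at least one class, this already separates the shifted partitions, so
    their number is exactly the number of pairs. *)
Lemma sperner_system_shifts (S : {set {set {set 'I_m}}}) :
    sperner_system k.+1 S ->
  exists2 S' : {set {set {set 'I_(m + k.+1)}}},
    sperner_system k.+1 S' & #|S'| = k.+1 * #|S|.
Proof.
move=> spS; have /andP[/forall_inP kparS _] := spS.
pose shift_pair (Ps : {set {set 'I_m}} * 'I_k.+1) := shifted_partition Ps.1 Ps.2.
exists (shift_pair @: setX S setT); last first.
  rewrite card_in_imset ?cardsX ?cardsT ?card_ord 1?mulnC //.
  move=> [P s] [Q t] /setXP[PS _] /setXP[QS _] eqPQ; rewrite /= in PS QS.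
  have [A AP] : exists A, A \in P.
    by apply/set0Pn; rewrite -card_gt0; have /andP[_ /eqP->] := kparS P PS.
  have: extend_class A (shifted_label P s A) \in shift_pair (P, s).
    exact: imset_f.
  rewrite eqPQ => /imsetP[B BQ eqAB].
  by apply: (shifted_class_inj spS PS QS AP BQ); rewrite eqAB.
apply/andP; split; apply/forall_inP => _ /imsetP[[P s] /setXP[/= PS _] ->].
  apply: extend_partition_kpartition; first exact: kparS.
  by apply: shifted_label_inj; have /andP[_ /eqP] := kparS P PS.
apply/forall_inP => _ /imsetP[[Q t] /setXP[/= QS _] ->]; apply/implyP => neqPQ.
apply/forall_inP => _ /imsetP[A AP ->]; apply/forall_inP => _ /imsetP[B BQ ->].
by apply: contraNN neqPQ => /(shifted_class_inj spS PS QS AP BQ) ->.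
Qed.

End CyclicShifts.

(** * The bound *)

Lemma SP_attained n k :
  exists2 S : {set {set {set 'I_n}}}, sperner_system k S & #|S| = SP n k.
Proof.
have sp0 : sperner_system k (set0 : {set {set {set 'I_n}}}).
  by apply/andP; split; apply/forall_inP => P; rewrite inE.
have card_gt0 : 0 < #|[pred S : {set {set {set 'I_n}}} | sperner_system k S]|.
  by apply/card_gt0P; exists set0.
have [S spS eqS] :=
  eq_bigmax_cond (fun S : {set {set {set 'I_n}}} => #|S|) card_gt0.
by exists S => //; rewrite -eqS; apply: eq_bigl.
Qed.

Theorem theorem6p1 (n k : nat) (hn : 0 < n) (hk : 0 < k) (hkn : k <= n) :
  k * SP (n - k) k <= SP n k.
Proof.
case: k hk hkn => // k _ hkn.
rewrite -{2}(subnK hkn); have [S spS <-] := SP_attained (n - k.+1) k.+1.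
have [S' spS' <-] := sperner_system_shifts spS.
exact: (leq_bigmax_cond (F := fun S0 : {set {set {set 'I__}}} => #|S0|)).
Qed.
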